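(* Let $n,p,k$ be positive integers with $k\le\min(n,p)$, $\lambda>0$, $\boldsymbol X=[\boldsymbol x_1,\dots,\boldsymbol x_p]\in\mathbb R^{n\times p}$, $\boldsymbol y\in\mathbb R^n$, and let $$v^*=\min_{\boldsymbol\beta\in\mathbb R^p}\left\{\tfrac1n\|\boldsymbol y-\boldsymbol X\boldsymbol\beta\|_2^2+\lambda\|\boldsymbol\beta\|_2^2:\ \|\boldsymbol\beta\|_0\le k\right\}.$$ Suppose $p\ge k$. Then the output value $v^G$ of the greedy approach (described in the context) satisfies $$v^*\le v^G\le\frac{n\lambda+\theta_k}{n\lambda}\left(1-\frac{n^2\lambda^2\,\underline\theta}{(n\lambda+\theta_1)(n\lambda+\theta_k)^2}\log\left(\frac{p+1}{p+1-k}\right)\right)v^*,$$ where $\theta_s=\max_{S\subseteq[p],|S|=s}\sigma_{\max}(\boldsymbol X_S\boldsymbol X_S^\top)$ and $\underline\theta=\min_{T\subseteq[p],\,|T|\ge p-k+1}\sigma_{\min}(\boldsymbol X_T\boldsymbol X_T^\top)$.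
   Context: $[p]=\{1,\dots,p\}$; $\|\boldsymbol\beta\|_0$ is the number of nonzero entries of $\boldsymbol\beta$; $\boldsymbol X_S$ is the submatrix of $\boldsymbol X$ consisting of the columns indexed by $S$; $\sigma_{\min}(\cdot)$ and $\sigma_{\max}(\cdot)$ denote the smallest and largest singular values (here of the $n\times n$ matrices $\boldsymbol X_S\boldsymbol X_S^\top$); $\log$ is the natural logarithm. For $S\subseteq[p]$ put $\boldsymbol A_S=n\lambda\boldsymbol I_n+\sum_{i\in S}\boldsymbol x_i\boldsymbol x_i^\top$. Greedy approach: start with $S=\emptyset$. Repeat $k$ times: choose $$j^*\in\arg\min_{j\in[p]\setminus S}\left\{-\frac{\lambda(\boldsymbol y^\top\boldsymbol A_S^{-1}\boldsymbol x_j)^2}{1+\boldsymbol x_j^\top\boldsymbol A_S^{-1}\boldsymbol x_j}\right\}$$ (ties broken arbitrarily) and replace $S$ by $S\cup\{j^*\}$. After $k$ steps output $v^G=\lambda\boldsymbol y^\top\boldsymbol A_S^{-1}\boldsymbol y$. *)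

(* Defs.v *)
From HB Require Import structures.
From mathcomp Require Import all_boot all_order all_algebra.
From mathcomp Require Import boolp classical_sets reals exp.
Set Implicit Arguments.
Unset Strict Implicit.
Unset Printing Implicit Defensive.
Import Order.TTheory GRing.Theory Num.Theory.
Local Open Scope classical_set_scope.
Local Open Scope ring_scope.

(* The attained maximum and minimum of a set of reals.  The value is the junk
   value 0 when no element of A bounds A, so this is not [sup] or [inf]. *)
Definition setmax (R : realType) (A : set R) : R := xget 0 (A `&` ubound A).
Definition setmin (R : realType) (A : set R) : R := xget 0 (A `&` lbound A).

Lemma setmaxE (R : realType) (A : set R) (m : R) :
  A m -> (forall x, A x -> x <= m) -> setmax A = m.
Proof.
move=> Am ub; apply: xget_unique; first by split=> // x /ub.
by move=> z [Az ubz]; apply/eqP; rewrite eq_le ub //= ubz.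
Qed.

Lemma setminE (R : realType) (A : set R) (m : R) :
  A m -> (forall x, A x -> m <= x) -> setmin A = m.
Proof.
move=> Am lb; apply: xget_unique; first by split=> // x /lb.
by move=> z [Az lbz]; apply/eqP; rewrite eq_le lb // lbz.
Qed.

(* Singular values of a square matrix: nonnegative square roots of the
   eigenvalues of the Gram matrix. *)
Definition singular_values (R : realType) (n : nat) (A : 'M[R]_n) : set R :=
  [set s | 0 <= s /\ eigenvalue (A^T *m A) (s ^+ 2)].

Definition sigma_max (R : realType) (n : nat) (A : 'M[R]_n) : R :=
  setmax (singular_values A).

Definition sigma_min (R : realType) (n : nat) (A : 'M[R]_n) : R :=
  setmin (singular_values A).

Section SparseRidge.
Variables (R : realType) (n p : nat) (X : 'M[R]_(n, p)).

Definition sqnorm (m : nat) (v : 'cV[R]_m) : R := \sum_i v i 0 ^+ 2.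

Definition l0norm (m : nat) (v : 'cV[R]_m) : nat := #|[pred i | v i 0 != 0]|.

Definition subcols (S : {set 'I_p}) : 'M[R]_(n, #|S|) :=
  colsub (@enum_val _ (mem S)) X.

Definition theta (s : nat) : R :=
  setmax [set sigma_max (subcols S *m (subcols S)^T)
         | S in [set S : {set 'I_p} | #|S| = s]].

Definition theta_low (k : nat) : R :=
  setmin [set sigma_min (subcols T *m (subcols T)^T)
         | T in [set T : {set 'I_p} | (p - k + 1 <= #|T|)%N]].

Variables (lambda : R) (y : 'cV[R]_n).

Definition ridge_objective (beta : 'cV[R]_p) : R :=
  n%:R^-1 * sqnorm (y - X *m beta) + lambda * sqnorm beta.

Definition vstar (k : nat) : R :=
  setmin [set ridge_objective beta
         | beta in [set beta : 'cV[R]_p | (l0norm beta <= k)%N]].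

Definition ridge_mx (S : {set 'I_p}) : 'M[R]_n :=
  (n%:R * lambda)%:M + \sum_(i in S) col i X *m (col i X)^T.

Definition greedy_score (S : {set 'I_p}) (j : 'I_p) : R :=
  - (lambda * (y^T *m invmx (ridge_mx S) *m col j X) 0 0 ^+ 2
     / (1 + ((col j X)^T *m invmx (ridge_mx S) *m col j X) 0 0)).

(* [greedy_run m S]: S is a possible content of the selected set after m
   iterations; a relation, since ties are broken arbitrarily. *)
Inductive greedy_run : nat -> {set 'I_p} -> Prop :=
| greedy_start : greedy_run 0 finset.set0
| greedy_step (m : nat) (S : {set 'I_p}) (j : 'I_p) :
    greedy_run m S ->
    j \notin S ->
    (forall i : 'I_p, i \notin S -> greedy_score S j <= greedy_score S i) ->
    greedy_run m.+1 (j |: S)%SET.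

Definition greedy_value (S : {set 'I_p}) : R :=
  lambda * (y^T *m invmx (ridge_mx S) *m y) 0 0.

End SparseRidge.

(* Main.v *)
Require Import Defs.
From HB Require Import structures.
From mathcomp Require Import all_boot all_order all_algebra.
From mathcomp Require Import complex polyrcf ring lra zify.
From mathcomp Require Import boolp classical_sets reals exp.
Import Order.TTheory GRing.Theory Num.Theory.
Local Open Scope sesquilinear_scope.
Local Open Scope ring_scope.

(* Write c = n lambda, A_S = c I + X_S X_S^T and u_S = A_S^-1 y.  Completing the
   square shows that the ridge problem restricted to the support S has value
   h(S) = lambda y^T u_S, so v* is the minimum of h over the sets S of size at
   most k and c h(empty set) = lambda |y|^2 <= (c + theta_k) v*.  By Sherman-Morrison a
   greedy step lowers h by the opposite of the score; the best gain is at least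
   the average over the p - |S| remaining columns, where
     sum_(i notin S) (x_i^T u_S)^2 >= theta_low |u_S|^2
                                   >= theta_low |y|^2 / (c + theta_k)^2
   and 1 + x_i^T A_S^-1 x_i <= (c + theta_1) / c.  The gains add up to a
   multiple of the sum of the 1 / (p - s) for s < k, which dominates
   ln ((p + 1) / (p + 1 - k)). *)

Set Implicit Arguments.
Unset Strict Implicit.

(** * Diagonalisation of real quadratic forms *)

Lemma sqnormE (R : realType) (m : nat) (u : 'cV[R]_m) : sqnorm u = (u^T *m u) 0 0.
Proof. by rewrite mxE; apply: eq_bigr => i _; rewrite mxE expr2. Qed.

(** The complexified matrix is hermitian, so a unitary [P] diagonalises it with real eigenvalues.
    The weight [q u i] is the squared modulus of the [i]-th coordinate of [P u]; these weights take
    the place of coordinates in a real eigenbasis. *)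
Lemma sym_spectral (R : realType) (n : nat) (M : 'M[R]_n) : M^T = M ->
  exists (d : 'I_n -> R) (q : 'cV[R]_n -> 'I_n -> R),
    (forall i, eigenvalue M (d i)) /\
    forall u, [/\ forall i, 0 <= q u i,
      sqnorm u = \sum_i q u i &
      (u^T *m M *m u) 0 0 = \sum_i d i * q u i].
Proof.
move=> Msym; pose f : {rmorphism R -> R[i]} := real_complex R.
pose Mc := map_mx f M.
have Mherm : Mc \is hermsymmx.
  apply: realsym_hermsym; last first.
    by apply/mxOverP => i j; rewrite mxE; apply/complex_realP; exists (M i j).
  apply/is_hermitianmxP; rewrite expr0 scale1r map_mx_id//.
  by rewrite /Mc map_trmx Msym.
pose P := spectralmx Mc.
have Pu : P \is unitarymx by apply: spectral_unitarymx.
have Pi := invmx_unitary Pu; have Punit := unitarymx_unit Pu.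
have /(orthomx_spectralP) := hermitian_normalmx Mherm.
set D := spectral_diag Mc; rewrite -/P Pi => MD.
have Dreal i : exists k, D 0 i = f k.
  by apply/complex_realP; move/mxOverP: (hermitian_spectral_diag_real Mherm); apply.
(* [Dreal] ensures that the default 0 is never taken. *)
pose d i := xget 0 [set k | D 0 i = f k]%classic.
have dE i : D 0 i = f (d i) by have [k Dk] := Dreal i; exact: (xgetPex 0 (Dreal i)).
pose w (u : 'cV[R]_n) := P *m map_mx f u.
have fRe (z : R[i]) : f (complex.Re (`|z| ^+ 2)) = `|z| ^+ 2.
  by apply: RRe_real; rewrite rpredX // normr_real.
exists d, (fun u i => complex.Re (`|w u i 0| ^+ 2)); split.
  move=> i; rewrite eigenvalue_root_char -(fmorph_root f) map_char_poly.
  rewrite -eigenvalue_root_char -dE -/Mc.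
  (* Since [P Mc = D P], the rows of [P] are left eigenvectors; they are nonzero because [P] is
     invertible. *)
  apply/eigenvalueP; exists (row i P).
    rewrite MD -row_mul !mulmxA -Pi mulmxV // mul1mx.
    by apply/rowP => j; rewrite mul_diag_mx !mxE.
  apply/eqP => /(congr1 (mulmx ^~ (invmx P))).
  rewrite -row_mul mulmxV // mul0mx => /rowP /(_ i).
  by rewrite !mxE eqxx => /eqP; rewrite oner_eq0.
(* Used twice: the identity with [e = 1] gives the norm, and [M] with [e = d] gives the quadratic
   form. *)
have key (N : 'M[R]_n) (e : 'I_n -> R) (u : 'cV[R]_n) :
    map_mx f N = P ^t* *m diag_mx (\row_i f (e i)) *m P ->
    (u^T *m N *m u) 0 0 = \sum_i e i * complex.Re (`|w u i 0| ^+ 2).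
  move=> NE; apply: (fmorph_inj f).
  have -> : f ((u^T *m N *m u) 0 0) = (map_mx f (u^T *m N *m u)) 0 0 by rewrite [RHS]mxE.
  have uE : map_mx f u^T = (map_mx f u)^t*.
    apply/matrixP => i j; rewrite !mxE; apply/esym/CrealP/complex_realP.
    by exists (u j i).
  rewrite !map_mxM NE uE.
  have -> : (map_mx f u)^t* *m (P ^t* *m diag_mx (\row_i f (e i)) *m P) *m map_mx f u
    = (w u)^t* *m diag_mx (\row_i f (e i)) *m w u.
    by rewrite /w trmx_mul map_mxM !mulmxA.
  rewrite rmorph_sum mxE; apply: eq_bigr => i _.
  rewrite mul_mx_diag !mxE rmorphM mulrAC mulrC; congr (_ * _).
  by rewrite fRe normCK mulrC.
move=> u; split.
- by move=> i; rewrite -ler0c [(complex.Re _)%:C%C]fRe exprn_ge0.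
- rewrite sqnormE -[X in X *m _]mulmx1 (key 1%:M (fun=> 1)).
    by apply: eq_bigr => i _; rewrite mul1r.
  rewrite map_mx1 -Pi; have -> : diag_mx (\row_i f 1) = 1%:M :> 'M_n.
    by apply/matrixP => i j; rewrite !mxE rmorph1.
  by rewrite mulmx1 mulVmx.
- apply: key; suff <- : D = \row_i f (d i) by exact: MD.
  by apply/rowP => i; rewrite mxE dE.
Qed.

(** * Attained extrema of finite sets of reals *)

(** Induction on [l]: the head is removed from [P] and then compared with the extremum of what is
    left. Containment in [l] is enough, so [P] may be any subset of a known finite list. *)
Lemma seq_extremum (T : eqType) (r : rel T) (P : T -> Prop) (l : seq T) :
  total r -> transitive r -> (exists x, P x) -> (forall x, P x -> x \in l) ->
  exists m, P m /\ forall x, P x -> r m x.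
Proof.
move=> rtot rtr [x0 Px0]; elim: l P x0 Px0 => [|a l IH] P x0 Px0 Pl.
  by have := Pl _ Px0.
have rr x : r x x by have := rtot x x; rewrite orbb.
have [[y [Py ya]]|noy] := pselect (exists y, P y /\ y != a); last first.
  have eqa x : P x -> x = a.
    by move=> Px; apply: contrapT => /eqP xa; apply: noy; exists x.
  by exists x0; split=> // x /eqa->; rewrite (eqa _ Px0).
have [||m [[Pm ma] mP]] := IH (fun x => P x /\ x != a) y.
- by [].
- by move=> x [/Pl]; rewrite inE => /orP[->|].
have [Pa|nPa] := pselect (P a); last first.
  exists m; split=> // x Px; apply: mP; split=> //.
  by apply/eqP => xa; apply: nPa; rewrite -xa.
have /orP[ram|rma] := rtot a m.
  exists a; split=> // x Px; have [->//|xa] := eqVneq x a.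
  by apply: rtr ram _; apply: mP.
by exists m; split=> // x Px; have [->//|xa] := eqVneq x a; apply: mP.
Qed.

(** Rules out the default value of [setmax]. *)
Lemma setmax_seq (R : realType) (A : set R) (l : seq R) :
  (exists x, A x) -> (forall x, A x -> x \in l) ->
  A (setmax A) /\ forall x, A x -> x <= setmax A.
Proof.
move=> A0 Al; have [| |m [Am mP]] := seq_extremum (r := >=%R) _ _ A0 Al.
- exact: ge_total.
- exact: ge_trans.
by rewrite (setmaxE Am).
Qed.

Lemma setmin_seq (R : realType) (A : set R) (l : seq R) :
  (exists x, A x) -> (forall x, A x -> x \in l) ->
  A (setmin A) /\ forall x, A x -> setmin A <= x.
Proof.
move=> A0 Al; have [| |m [Am mP]] := seq_extremum (r := <=%R) _ _ A0 Al.
- exact: le_total.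
- exact: le_trans.
by rewrite (setminE Am).
Qed.

Lemma setmax_image (R : realType) (T : finType) (P : set T) (f : T -> R) (x : T) :
  P x -> f x <= setmax [set f z | z in P]%classic.
Proof.
move=> Px; apply: (setmax_seq (l := map f (enum T)) _ _).2; last by exists x.
- by exists (f x), x.
- by move=> _ [z _ <-]; rewrite map_f ?mem_enum.
Qed.

Lemma setmin_image (R : realType) (T : finType) (P : set T) (f : T -> R) (x : T) :
  P x -> exists2 z, P z & setmin [set f z | z in P]%classic = f z /\
    forall t, P t -> f z <= f t.
Proof.
move=> Px; have [||[z Pz zE] zP] :=
  setmin_seq (A := [set f z | z in P]%classic) (l := map f (enum T)).
- by exists (f x), x.
- by move=> _ [z _ <-]; rewrite map_f ?mem_enum.
by exists z => //; split=> // t Pt; rewrite zE; apply: zP; exists t.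
Qed.

(** * Singular values of Gram matrices *)

Lemma sigma_max_min_ge0 (R : realType) (n : nat) (A : 'M[R]_n) :
  0 <= sigma_max A /\ 0 <= sigma_min A.
Proof.
rewrite /sigma_max /setmax /sigma_min /setmin; split; case: xgetP => //.
  by move=> s _ [[]].
by move=> s _ [[]].
Qed.

(** The square of a singular value is a root of the characteristic polynomial of [A^T *m A], which
    has finitely many roots. Hence [sigma_max] and [sigma_min] are attained as soon as one singular
    value exists. *)
Lemma singular_values_seq (R : realType) (n : nat) (A : 'M[R]_n) :
  exists l : seq R, forall s, singular_values A s -> s \in l.
Proof.
pose c := char_poly (A^T *m A).
exists (map Num.sqrt (rootsR c)) => s [s0].
rewrite eigenvalue_root_char => rs.
have -> : s = Num.sqrt (s ^+ 2) by rewrite sqrtr_sqr ger0_norm.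
apply: map_f; have := roots_on_rootsR (monic_neq0 (char_poly_monic (A^T *m A))).
by move=> /(_ (s ^+ 2)) <-; rewrite rs andbT itv_boundlr.
Qed.

Lemma gram_quad (R : realType) (n m : nat) (Z : 'M[R]_(n, m)) (u : 'cV[R]_n) :
  (u^T *m (Z *m Z^T) *m u) 0 0 = sqnorm (Z^T *m u).
Proof. by rewrite sqnormE trmx_mul trmxK !mulmxA. Qed.

Lemma sqnorm_ge0 (R : realType) (m : nat) (u : 'cV[R]_m) : 0 <= sqnorm u.
Proof. by apply: sumr_ge0 => i _; rewrite sqr_ge0. Qed.

Lemma sqnorm_eq0 (R : realType) (m : nat) (u : 'cV[R]_m) : (sqnorm u == 0) = (u == 0).
Proof.
apply/idP/eqP => [|->]; last by rewrite sqnormE mulmx0 mxE.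
rewrite psumr_eq0 => [/allP u0|i _]; last by rewrite sqr_ge0.
apply/colP => i; rewrite mxE; apply/eqP; rewrite -sqrf_eq0.
by apply: (implyP (u0 i _)); rewrite ?mem_index_enum.
Qed.

(** The eigenvalues of the positive semidefinite [G] are singular values of [G], and
    [sqnorm (Z^T *m u)] is the sum of these eigenvalues with nonnegative weights of total
    [sqnorm u]. *)
Lemma gram_sigma (R : realType) (n m : nat) (Z : 'M[R]_(n, m)) (u : 'cV[R]_n) :
  let G := Z *m Z^T in
  sigma_min G * sqnorm u <= sqnorm (Z^T *m u) /\
  sqnorm (Z^T *m u) <= sigma_max G * sqnorm u.
Proof.
move=> G; have Gsym : G^T = G by rewrite trmx_mul trmxK.
have [d [q [deig dq]]] := sym_spectral Gsym.
(* At an eigenvector [v] the quadratic form gives [d i * sqnorm v^T = sqnorm (Z^T *m v^T)]. *)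
have d0 i : 0 <= d i.
  have /eigenvalueP[v vG v0] := deig i.
  have v0' : 0 < sqnorm v^T.
    by rewrite lt_neqAle sqnorm_ge0 eq_sym sqnorm_eq0 trmx_eq0 v0.
  have := gram_quad Z v^T; rewrite -/G trmxK vG -scalemxAl mxE.
  have {1}<- := trmxK v; rewrite -sqnormE => E.
  by rewrite -(pmulr_lge0 _ v0') E sqnorm_ge0.
have dsing i : singular_values G (d i).
  split=> //; have /eigenvalueP[v vG v0] := deig i.
  apply/eigenvalueP; exists v => //.
  by rewrite Gsym mulmxA vG -scalemxAl vG scalerA expr2.
have dmax i : d i <= sigma_max G.
  have [l lP] := singular_values_seq G.
  by apply: (setmax_seq _ lP).2 (dsing i); exists (d i).
have dmin i : sigma_min G <= d i.
  have [l lP] := singular_values_seq G.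
  by apply: (setmin_seq _ lP).2 (dsing i); exists (d i).
have [q0 uE uGE] := dq u; rewrite gram_quad in uGE; rewrite uGE uE !mulr_sumr.
by split; apply: ler_sum => i _; rewrite ler_wpM2r.
Qed.

(** * Inner products *)

Definition dot (R : realType) (m : nat) (u v : 'cV[R]_m) : R := (u^T *m v) 0 0.

Section Dot.
Variables (R : realType).
Implicit Types m : nat.

Lemma dotC m (u v : 'cV[R]_m) : dot u v = dot v u.
Proof. by rewrite /dot -[v in LHS]trmxK -trmx_mul mxE. Qed.

Lemma dotDr m (u v w : 'cV[R]_m) : dot u (v + w) = dot u v + dot u w.
Proof. by rewrite /dot mulmxDr mxE. Qed.

Lemma dotZr m (a : R) (u v : 'cV[R]_m) : dot u (a *: v) = a * dot u v.
Proof. by rewrite /dot -scalemxAr mxE. Qed.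

Lemma dotMr m l (A : 'M[R]_(m, l)) u v : dot u (A *m v) = dot (A^T *m u) v.
Proof. by rewrite /dot trmx_mul trmxK mulmxA. Qed.

Lemma sqnorm_dot m (u : 'cV[R]_m) : sqnorm u = dot u u.
Proof. exact: sqnormE. Qed.

Lemma sqnormD m (u v : 'cV[R]_m) :
  sqnorm (u + v) = sqnorm u + 2 * dot u v + sqnorm v.
Proof.
rewrite !sqnorm_dot dotDr ![dot (u + v) _]dotC !dotDr (dotC v u); ring.
Qed.

Lemma sqnormZ m a (u : 'cV[R]_m) : sqnorm (a *: u) = a ^+ 2 * sqnorm u.
Proof. by rewrite !sqnorm_dot dotZr dotC dotZr; ring. Qed.

(* Expand [dot (B u - A u) (A (B u - A u)) >= 0]. *)
Lemma sqnorm_mulmx_le m (A : 'M[R]_m) (B : R) (u : 'cV[R]_m) :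
  A^T = A -> 0 < B ->
  (forall v, 0 <= dot v (A *m v)) ->
  (forall v, dot v (A *m v) <= B * sqnorm v) ->
  sqnorm (A *m u) <= B * dot u (A *m u).
Proof.
move=> Asym B0 A0 AB; have := A0 (B *: u + - 1 *: (A *m u)).
have := AB (A *m u); set w := A *m u => wB.
have Auw : dot u (A *m w) = sqnorm w by rewrite dotMr Asym sqnorm_dot.
rewrite mulmxDr -!scalemxAr -/w !dotDr !dotZr ![dot (_ + _) _]dotC.
rewrite !dotDr !dotZr -sqnorm_dot => H.
move: H; rewrite (dotC u w) [dot (A *m w) u]dotC Auw (dotC (A *m w)) => H.
by rewrite -(ler_pM2l B0); lra.
Qed.
End Dot.

(** [theta] ranges over sets of exactly [k] columns, so smaller supports have to be enlarged. *)
Lemma superset_card (T : finType) (S : {set T}) k : (#|S| <= k <= #|T|)%N ->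
  exists2 U : {set T}, S \subset U & #|U| = k.
Proof.
elim: k => [|k IH] /andP[Sk kT].
  by exists S => //; apply/eqP; rewrite -leqn0.
move: Sk; rewrite leq_eqVlt => /orP[/eqP Sk|Sk]; first by exists S.
have [|U SU Uk] := IH; first by rewrite -ltnS Sk ltnW.
have [j jU] : exists j, j \notin U.
  apply/existsP; apply: contraLR kT; rewrite negb_exists => /forallP UT.
  rewrite -leqNgt -Uk -cardsT; apply/subset_leq_card/fintype.subsetP => j _.
  by have := UT j; rewrite negbK.
by exists (j |: U)%SET; rewrite ?cardsU1 ?jU ?Uk // finset.subsetU // SU orbT.
Qed.

(** * Column sums bounded by [theta] and [theta_low] *)

Section Ridge.
Variables (R : realType) (n p : nat) (X : 'M[R]_(n, p)).
Implicit Types (S T : {set 'I_p}) (u : 'cV[R]_n) (j : 'I_p).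

Lemma subcols_gram S :
  subcols X S *m (subcols X S)^T = \sum_(i in S) col i X *m (col i X)^T.
Proof.
apply/matrixP => a b; rewrite mxE summxE.
rewrite (eq_bigr (fun i => X a i * X b i)); last first.
  by move=> i _; rewrite mxE big_ord1 !mxE.
by rewrite [RHS]big_enum_val; apply: eq_bigr => i _; rewrite !mxE.
Qed.

Lemma sqnorm_subcols S u :
  sqnorm ((subcols X S)^T *m u) = \sum_(i in S) (X^T *m u) i 0 ^+ 2.
Proof.
rewrite [RHS]big_enum_val; apply: eq_bigr => i _; rewrite !mxE; congr (_ ^+ 2).
by apply: eq_bigr => l _; rewrite !mxE.
Qed.

Lemma theta_sum k S u : (#|S| <= k <= p)%N ->
  \sum_(i in S) (X^T *m u) i 0 ^+ 2 <= theta X k * sqnorm u.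
Proof.
move=> Skp; have [|T ST Tk] := @superset_card _ S k; first by rewrite card_ord.
apply: (@le_trans _ _ (\sum_(i in T) (X^T *m u) i 0 ^+ 2)).
  rewrite [leRHS](big_setID S) /= (finset.setIidPr ST) lerDl.
  by apply: sumr_ge0 => i _; rewrite sqr_ge0.
rewrite -sqnorm_subcols; apply: le_trans (gram_sigma _ _).2 _.
rewrite ler_wpM2r ?sqnorm_ge0 //.
exact: (@setmax_image _ _ [set S : {set 'I_p} | #|S| = k]%classic).
Qed.

Lemma theta_ge0 k : 0 <= theta X k.
Proof.
rewrite /theta /setmax; case: xgetP => // s _ [[T _ <-] _].
exact: (sigma_max_min_ge0 _).1.
Qed.

(** [theta_sum] for the singleton of [j], taken at [u = x_j], reads $|x_j|^4 \le \theta_1 |x_j|^2$;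
    a factor $|x_j|^2$ cancels unless it is zero. *)
Lemma theta1_col j : (0 < p)%N -> sqnorm (col j X) <= theta X 1.
Proof.
move=> p0; have := @theta_sum 1 [set j]%SET (col j X); rewrite cards1 p0 => /(_ isT).
rewrite big_set1; have -> : (X^T *m col j X) j 0 = sqnorm (col j X).
  by rewrite mxE; apply: eq_bigr => i _; rewrite !mxE expr2.
have := sqnorm_ge0 (col j X); rewrite le_eqVlt => /orP[/eqP<- _|s0].
  exact: theta_ge0.
by rewrite expr2 ler_pM2r.
Qed.

Lemma theta_low_ge0 k : 0 <= theta_low X k.
Proof.
rewrite /theta_low /setmin; case: xgetP => // s _ [[T _ <-] _].
exact: (sigma_max_min_ge0 _).2.
Qed.

Lemma theta_low_sum k T u : (p - k + 1 <= #|T|)%N ->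
  theta_low X k * sqnorm u <= \sum_(i in T) (X^T *m u) i 0 ^+ 2.
Proof.
move=> Tk; rewrite -sqnorm_subcols; apply: le_trans _ (gram_sigma _ _).1.
rewrite ler_wpM2r ?sqnorm_ge0 // /theta_low.
have [|U _ [-> Umin]] := @setmin_image R _
  [set T : {set 'I_p} | (p - k + 1 <= #|T|)%N]%classic
  (fun T => sigma_min (subcols X T *m (subcols X T)^T)) T; first exact: Tk.
exact: Umin.
Qed.

(** * Spectral bounds for the regularised matrix [A S] *)

Variables (lambda : R) (y : 'cV[R]_n).
Hypothesis (n_gt0 : (0 < n)%N) (lambda_gt0 : 0 < lambda).
Let c := n%:R * lambda.
Let A S := ridge_mx X lambda S.
(** The vector $u_S = A_S^{-1} y$. *)
Let v S := invmx (A S) *m y.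

Lemma ridge_c_gt0 : 0 < c. Proof. by rewrite mulr_gt0 ?ltr0n. Qed.

Lemma ridge_mxE S : A S = c%:M + subcols X S *m (subcols X S)^T.
Proof. by rewrite subcols_gram. Qed.

Lemma ridge_sym S : (A S)^T = A S.
Proof. by rewrite ridge_mxE linearD /= tr_scalar_mx trmx_mul trmxK. Qed.

Lemma ridge_mulmx S u :
  A S *m u = c *: u + subcols X S *m (subcols X S)^T *m u.
Proof. by rewrite ridge_mxE mulmxDl mul_scalar_mx. Qed.

Lemma ridge_dot S u :
  dot u (A S *m u) = c * sqnorm u + \sum_(i in S) (X^T *m u) i 0 ^+ 2.
Proof.
rewrite ridge_mulmx dotDr dotZr -sqnorm_dot -sqnorm_subcols.
by rewrite /dot mulmxA gram_quad.
Qed.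

Lemma ridge_dot_ge S u : c * sqnorm u <= dot u (A S *m u).
Proof. by rewrite ridge_dot lerDl sumr_ge0 // => i _; rewrite sqr_ge0. Qed.

Lemma ridge_dot_ge0 S u : 0 <= dot u (A S *m u).
Proof.
apply: le_trans (ridge_dot_ge S u).
by rewrite mulr_ge0 ?sqnorm_ge0 // ltW // ridge_c_gt0.
Qed.

(** Positive definiteness: a kernel vector [w] satisfies [c * sqnorm w <= 0]. *)
Lemma ridge_unit S : A S \in unitmx.
Proof.
rewrite -row_free_unit -kermx_eq0; apply/eqP/row_matrixP => i; rewrite row0.
apply: trmx_inj; set w := (row i _)^T; rewrite trmx0.
have Aw : A S *m w = 0.
  by rewrite /w -{1}(ridge_sym S) -trmx_mul -row_mul mulmx_ker row0 trmx0.
have := ridge_dot_ge S w; rewrite Aw /dot mulmx0 mxE pmulr_rle0 ?ridge_c_gt0 //.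
by move=> w0; apply/eqP; rewrite -sqnorm_eq0 eq_le w0 sqnorm_ge0.
Qed.

(** With $G = X_S X_S^T$, the difference of the two sides is $c\,u^T G u + |G u|^2$. At $u =
    A_S^{-1} x$ this yields $c\,x^T A_S^{-1} x \le |x|^2$. *)
Lemma ridge_sqnorm_ge S u : c * dot u (A S *m u) <= sqnorm (A S *m u).
Proof.
rewrite [in leRHS]ridge_mulmx sqnormD sqnormZ.
have := sqnorm_ge0 (subcols X S *m (subcols X S)^T *m u).
have c0 := ridge_c_gt0.
have : dot u (subcols X S *m (subcols X S)^T *m u) = \sum_(i in S) (X^T *m u) i 0 ^+ 2.
  by rewrite -sqnorm_subcols /dot mulmxA gram_quad.
rewrite ridge_dot [dot (c *: _) _]dotC dotZr dotC => ->.
have : 0 <= \sum_(i in S) (X^T *m u) i 0 ^+ 2.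
  by apply: sumr_ge0 => i _; rewrite sqr_ge0.
nra.
Qed.

Lemma ridge_dot_le k S u : (#|S| <= k <= p)%N ->
  dot u (A S *m u) <= (c + theta X k) * sqnorm u.
Proof. by move=> Sk; rewrite ridge_dot mulrDl lerD2l theta_sum. Qed.

Lemma ridge_sqnorm_le k S u : (#|S| <= k <= p)%N ->
  sqnorm (A S *m u) <= (c + theta X k) * dot u (A S *m u).
Proof.
move=> Sk; apply: sqnorm_mulmx_le => [||w|w].
- exact: ridge_sym.
- by rewrite ltr_pwDl ?ridge_c_gt0 ?theta_ge0.
- exact: ridge_dot_ge0.
- exact: ridge_dot_le.
Qed.

(** * Value of the ridge problem on a fixed support *)

Lemma ridge_solveK S : A S *m v S = y.
Proof. by rewrite mulKVmx // ridge_unit. Qed.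

Lemma greedy_valueE S : greedy_value X lambda y S = lambda * dot (v S) (A S *m v S).
Proof. by rewrite ridge_solveK dotC /greedy_value /dot mulmxA. Qed.

(** Since the left side is [c] times the value of the empty set, this compares the starting value of
    the greedy run with the value of any support of size at most [k], in particular an optimal
    one. *)
Lemma greedy_value_ge k S : (#|S| <= k <= p)%N ->
  lambda * sqnorm y <= (c + theta X k) * greedy_value X lambda y S.
Proof.
move=> Sk; rewrite greedy_valueE mulrCA ler_pM2l //.
by have := ridge_sqnorm_le (v S) Sk; rewrite ridge_solveK.
Qed.

(** The ridge minimiser on the support [S]: the vector $X_S^T u_S$ extended by zero. *)
Let b S := \col_j (if j \in S then (X^T *m v S) j 0 else 0).

(** The residual of [b S] is [c *: u], so that of [beta] is [c *: u - X *m d]. The cross terms of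
    the two squares cancel because [c / n = lambda] and $X^T u$ agrees with [b S] on the support of
    [d]. *)
Lemma ridge_decomp S (beta : 'cV[R]_p) :
  (forall j, j \notin S -> beta j 0 = 0) ->
  ridge_objective X lambda y beta = greedy_value X lambda y S
    + (n%:R^-1 * sqnorm (X *m (beta - b S)) + lambda * sqnorm (beta - b S)).
Proof.
move=> beta0; set d := beta - b S; set u := v S.
have Xb : subcols X S *m (subcols X S)^T *m u = X *m b S.
  rewrite subcols_gram mulmx_suml; apply/colP => i; rewrite summxE [RHS]mxE big_mkcond.
  apply: eq_bigr => j _; rewrite [in RHS]mxE; case: ifP => _; last by rewrite mulr0.
  rewrite -mulmxA mxE big_ord1 !mxE; congr (_ * _).
  by apply: eq_bigr => l _; rewrite !mxE.
rewrite /ridge_objective; have -> : y - X *m beta = c *: u + - 1 *: (X *m d).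
  rewrite -{1}(ridge_solveK S) ridge_mulmx Xb /d mulmxBr scaleN1r opprB.
  by rewrite addrA.
have -> : beta = b S + d by rewrite addrC subrK.
rewrite !sqnormD !sqnormZ greedy_valueE ridge_dot dotZr [dot (c *: u) _]dotC dotZr.
(* Off [S], where [b S] and $X^T u$ may differ, [d] vanishes. *)
have -> : dot (X *m d) u = dot (b S) d.
  rewrite dotC dotMr /dot !mxE; apply: eq_bigr => j _; rewrite !mxE.
  case: ifPn => // jS; rewrite beta0 // subrr !mulr0 //.
have -> : sqnorm (b S) = \sum_(i in S) (X^T *m u) i 0 ^+ 2.
  rewrite [RHS]big_mkcond; apply: eq_bigr => i _; rewrite mxE.
  by case: ifP => // _; rewrite expr0n.
rewrite /c; field; by rewrite pnatr_eq0 -lt0n.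
Qed.

Lemma greedy_value_ge0 S : 0 <= greedy_value X lambda y S.
Proof. by rewrite greedy_valueE mulr_ge0 ?ridge_dot_ge0 // ltW. Qed.

(** There are finitely many supports, so a best one [S] exists. The minimum is attained at [b S],
    and any competitor [beta] is bounded below through its own support. *)
Lemma vstar_greedy_value k : exists2 S : {set 'I_p}, (#|S| <= k)%N &
  vstar X lambda y k = greedy_value X lambda y S /\
  forall T : {set 'I_p}, (#|T| <= k)%N ->
    greedy_value X lambda y S <= greedy_value X lambda y T.
Proof.
have [|S Sk [_ Smin]] := @setmin_image R _ [set S : {set 'I_p} | (#|S| <= k)%N]%classic
  (greedy_value X lambda y) finset.set0; first by rewrite /= cards0.
exists S => //; split=> //; apply: setminE => [|_ [beta betak <-]].
  exists (b S).
    apply: leq_trans Sk; apply/subset_leq_card/fintype.subsetP => i.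
    by rewrite inE mxE; case: ifP => //; rewrite eqxx.
  rewrite (@ridge_decomp S) => [|j /negbTE jS]; last by rewrite mxE jS.
  by rewrite subrr mulmx0 !sqnormE !mulmx0 !mxE !mulr0 !addr0.
pose T := [set i | beta i 0 != 0]%SET.
rewrite (@ridge_decomp T) => [|j]; last by rewrite inE negbK => /eqP.
apply: le_trans (Smin T _) _; first by rewrite /= cardsE.
by rewrite lerDl addr_ge0 // mulr_ge0 ?sqnorm_ge0 ?invr_ge0 // ltW.
Qed.

(** * Decrease of the value in one greedy step *)

Let w S j := invmx (A S) *m col j X.

Lemma dot_yw S j : dot y (w S j) = (X^T *m v S) j 0.
Proof.
rewrite -{1}(ridge_solveK S) dotC dotMr ridge_sym mulKVmx ?ridge_unit //.
by rewrite /dot !mxE; apply: eq_bigr => i _; rewrite !mxE.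
Qed.

Lemma dot_colw S j : dot (col j X) (w S j) = dot (w S j) (A S *m w S j).
Proof. by rewrite mulKVmx ?ridge_unit // dotC. Qed.

Lemma greedy_scoreE S j : greedy_score X lambda y S j =
  - (lambda * (X^T *m v S) j 0 ^+ 2 / (1 + dot (col j X) (w S j))).
Proof. by rewrite -dot_yw /greedy_score /dot !mulmxA. Qed.

(* Sherman-Morrison. *)
Lemma greedy_value_setU1 S j : j \notin S -> greedy_value X lambda y (j |: S)%SET =
  greedy_value X lambda y S + greedy_score X lambda y S j.
Proof.
move=> jS; set x := col j X; pose t := dot x (w S j); pose a := (X^T *m v S) j 0.
have t0 : 0 <= t by rewrite /t dot_colw ridge_dot_ge0.
have t1 : 1 + t != 0 by rewrite gt_eqF // ltr_pwDl.
have xz z : x *m x^T *m z = dot x z *: x.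
  by rewrite -mulmxA [x^T *m z]mx11_scalar mul_mx_scalar.
have AE : A (j |: S)%SET = A S + x *m x^T.
  by rewrite /A /ridge_mx big_setU1 //= [x *m _ + _]addrC addrA.
(* Checked by applying [A (j |: S)]: the coefficient of [w S j] is the one for which the terms along
   [x] cancel, as [a - a / (1 + t) * (1 + t) = 0]. *)
have vE : v (j |: S)%SET = v S + (- (a / (1 + t))) *: w S j.
  apply: (can_inj (mulKmx (ridge_unit (j |: S)%SET))).
  rewrite ridge_solveK mulmxDr -scalemxAr AE ![(A S + _) *m _]mulmxDl ridge_solveK.
  rewrite mulKVmx ?ridge_unit // !xz -/t.
  have -> : dot x (v S) = a by rewrite /a /dot !mxE; apply: eq_bigr => i _; rewrite !mxE.
  have -> : x + t *: x = (1 + t) *: x by rewrite scalerDl scale1r.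
  rewrite -addrA scalerA -scalerDl.
  by rewrite mulNr mulfVK // subrr scale0r addr0.
have gvE T : greedy_value X lambda y T = lambda * dot y (v T).
  by rewrite /greedy_value /dot mulmxA.
rewrite greedy_scoreE !gvE vE dotDr dotZr dot_yw -/a -/x -/t; by field.
Qed.

Lemma greedy_score_le S j : greedy_score X lambda y S j <=
  - (lambda * c / (c + theta X 1) * (X^T *m v S) j 0 ^+ 2).
Proof.
have p_gt0 : (0 < p)%N by apply: leq_ltn_trans (ltn_ord j).
rewrite greedy_scoreE lerN2; set a := _ ^+ 2; set t := dot _ _.
have t0 : 0 <= t by rewrite /t dot_colw ridge_dot_ge0.
(* [ridge_sqnorm_ge] at [w S j] gives [c * t <= sqnorm (col j X)]. *)
have ct : c * t <= theta X 1.
  apply: le_trans (theta1_col j p_gt0); rewrite /t dot_colw.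
  by apply: le_trans (ridge_sqnorm_ge _ _) _; rewrite mulKVmx ?ridge_unit.
have c0 := ridge_c_gt0; have th0 := theta_ge0 1.
have -> : lambda * c / (c + theta X 1) * a = lambda * a * c / (c + theta X 1) by ring.
rewrite ler_pdivrMr ?ltr_pwDl // [leRHS]mulrAC ler_pdivlMr ?ltr_pwDl //.
have a0 : 0 <= lambda * a by rewrite mulr_ge0 ?sqr_ge0 // ltW.
by rewrite -[leLHS]mulrA ler_wpM2l // mulrDr mulr1 lerD2l.
Qed.

(** The least score is at most the average score over the columns outside [S]. *)
Lemma greedy_gain k S j : (#|S| < k <= p)%N -> j \notin S ->
  (forall i, i \notin S -> greedy_score X lambda y S j <= greedy_score X lambda y S i) ->
  greedy_score X lambda y S j <=
  - (lambda * c * theta_low X k / ((c + theta X 1) * (c + theta X k) ^+ 2)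
     * sqnorm y / (p - #|S|)%:R).
Proof.
move=> /andP[Sk kp] jS jmin; set s := greedy_score _ _ _ _ _.
have c0 := ridge_c_gt0; have th1 := theta_ge0 1; have thk := theta_ge0 k.
have cardC : #|~: S| = (p - #|S|)%N by rewrite cardsCs finset.setCK card_ord.
have q0 : 0 < (p - #|S|)%:R :> R by rewrite ltr0n subn_gt0 (leq_trans Sk).
(* Two successive bounds: $|y|^2 \le (c+\theta_k)\,u_S^T A_S u_S$ and $u_S^T A_S u_S \le
   (c+\theta_k)|u_S|^2$. *)
have uy : sqnorm y <= (c + theta X k) ^+ 2 * sqnorm (v S).
  have Skp : (#|S| <= k <= p)%N by rewrite ltnW.
  have := ridge_sqnorm_le (v S) Skp; rewrite ridge_solveK => /le_trans -> //.
  rewrite expr2 -mulrA ler_pM2l ?ltr_pwDl // -(ridge_solveK S).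
  exact: ridge_dot_le.
have low : theta_low X k * sqnorm (v S) <= \sum_(i in ~: S) (X^T *m v S) i 0 ^+ 2.
  (* From [#|S| < k], the complement has at least [p - k + 1] elements, the threshold in
     [theta_low]. *)
  apply: theta_low_sum; rewrite cardC addn1 -subSn //.
  by rewrite leq_subLR addnBA ?leq_sub2r //; lia.
have sum_s : (p - #|S|)%:R * s <=
    - (lambda * c / (c + theta X 1) * \sum_(i in ~: S) (X^T *m v S) i 0 ^+ 2).
  rewrite mulr_sumr -sumrN -cardC mulr_natl -sumr_const; apply: ler_sum => i.
  by rewrite inE => iS; apply: le_trans (jmin i iS) (greedy_score_le _ _).
rewrite -mulNr ler_pdivlMr // mulrC; apply: le_trans sum_s _; rewrite lerN2.
set K := lambda * c / _.
have K0 : 0 <= K by rewrite divr_ge0 ?mulr_ge0 // ?addr_ge0 // ltW.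
apply: le_trans (ler_wpM2l K0 low).
have -> : lambda * c * theta_low X k / ((c + theta X 1) * (c + theta X k) ^+ 2) * sqnorm y
  = K * (theta_low X k * (sqnorm y / (c + theta X k) ^+ 2)).
  by rewrite /K; field; rewrite !gt_eqF // ltr_pwDl.
rewrite ler_wpM2l // ler_wpM2l ?theta_low_ge0 // ler_pdivrMr 1?mulrC //.
by rewrite exprn_gt0 // ltr_pwDl.
Qed.

(** * Accumulated decrease along a greedy run *)

Lemma greedy_run_card m S : greedy_run X lambda y m S -> #|S| = m.
Proof. by elim=> [|{}m {}S j _ Sm jS _]; rewrite ?cards0 // cardsU1 jS Sm. Qed.

Lemma greedy_value0 : greedy_value X lambda y finset.set0 = lambda * sqnorm y / c.
Proof.
have A0 : A finset.set0 = c%:M by rewrite /A /ridge_mx big_set0 addr0.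
have c0 := ridge_c_gt0.
rewrite /greedy_value -/(A _) A0 invmx_scalar mul_mx_scalar -scalemxAl mxE -sqnormE.
by rewrite [_^-1 * _]mulrC mulrA.
Qed.

(** With [q = p - m], the arguments of the two logarithms have ratio [1 + 1 / q], and $\ln(1+x) \le
    x$. *)
Lemma ln_succ_div (m : nat) : (m < p)%N ->
  ln ((p%:R + 1) / (p%:R + 1 - m.+1%:R)) <=
  ln ((p%:R + 1) / (p%:R + 1 - m%:R)) + (p - m)%:R^-1 :> R.
Proof.
move=> mp; have q0 : 0 < (p - m)%:R :> R by rewrite ltr0n subn_gt0.
have p0 : 0 < p%:R + 1 :> R by rewrite ltr_wpDl.
have -> : p%:R + 1 - m.+1%:R = (p - m)%:R :> R.
  by rewrite natrB 1?ltnW // -addn1 natrD opprD addrACA subrr addr0.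
have -> : p%:R + 1 - m%:R = (p - m)%:R + 1 :> R by rewrite natrB 1?ltnW // addrAC.
have -> : (p%:R + 1) / (p - m)%:R =
    (p%:R + 1) / ((p - m)%:R + 1) * (1 + (p - m)%:R^-1) :> R.
  by field; rewrite !gt_eqF // ltr_wpDl // ltW.
have i0 : 0 < (p - m)%:R^-1 :> R by rewrite invr_gt0.
have r0 : 0 < (p%:R + 1) / ((p - m)%:R + 1) :> R by rewrite divr_gt0 // addr_gt0.
rewrite lnM ?posrE ?addr_gt0 // lerD2l le_ln1Dx //.
by rewrite (lt_trans _ i0) // oppr_lt0.
Qed.

(** Induction on the run with [k] fixed and [m] varying, so that the same constant [K] serves every
    step; the step from [m] to [m.+1] gains at least [K / (p - m)]. *)
Lemma greedy_run_value_le k m S : (k <= p)%N -> greedy_run X lambda y m S -> (m <= k)%N ->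
  greedy_value X lambda y S <= lambda * sqnorm y / c
    - lambda * c * theta_low X k / ((c + theta X 1) * (c + theta X k) ^+ 2)
     * sqnorm y * ln ((p%:R + 1) / (p%:R + 1 - m%:R)).
Proof.
move=> kp; set K := _ * sqnorm y.
elim=> [_|{}m {}S j run IH jS jmin mk].
  rewrite subr0 divff ?ln1 ?mulr0 ?subr0 ?greedy_value0 //.
  by rewrite gt_eqF // ltr_wpDl.
have Sm := greedy_run_card run.
have := @greedy_gain k S j; rewrite Sm mk kp => /(_ isT jS jmin) gain.
rewrite greedy_value_setU1 //; apply: le_trans (lerD (IH (ltnW mk)) gain) _.
rewrite -addrA lerD2l -opprD lerN2 -mulrDr ler_wpM2l ?ln_succ_div ?(leq_trans mk) //.
have c0 := ridge_c_gt0.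
rewrite !mulr_ge0 ?sqnorm_ge0 ?theta_low_ge0 ?invr_ge0 //.
all: by rewrite ?mulr_ge0 ?exprn_ge0 ?addr_ge0 ?theta_ge0 // ltW.
Qed.
End Ridge.

Unset Implicit Arguments.

Theorem theorem3 (R : realType) (n p k : nat) (lambda : R)
    (X : 'M[R]_(n, p)) (y : 'cV[R]_n) (S : {set 'I_p})
    (n_gt0 : (0 < n)%N) (p_gt0 : (0 < p)%N) (k_gt0 : (0 < k)%N)
    (k_le_min : (k <= minn n p)%N) (lambda_gt0 : 0 < lambda)
    (k_le_p : (k <= p)%N)
    (S_greedy : greedy_run X lambda y k S) :
  let N : R := n%:R in
  vstar X lambda y k <= greedy_value X lambda y S
  /\ greedy_value X lambda y S <=
     (N * lambda + theta X k) / (N * lambda)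
     * (1 - N ^+ 2 * lambda ^+ 2 * theta_low X k
            / ((N * lambda + theta X 1) * (N * lambda + theta X k) ^+ 2)
            * ln ((p%:R + 1) / (p%:R + 1 - k%:R)))
     * vstar X lambda y k.
Proof.
move=> N; have [T Tk [-> Tmin]] := vstar_greedy_value X y n_gt0 lambda_gt0 k.
split; first by apply: Tmin; rewrite (greedy_run_card S_greedy).
have c0 : 0 < N * lambda := ridge_c_gt0 n_gt0 lambda_gt0.
have th1 := theta_ge0 X 1; have thk := theta_ge0 X k.
have Tkp : (#|T| <= k <= p)%N by rewrite Tk.
have := greedy_value_ge X y n_gt0 lambda_gt0 Tkp; rewrite -/N.
have := greedy_run_value_le n_gt0 lambda_gt0 k_le_p S_greedy (leqnn k).
rewrite -/N; have := greedy_value_ge0 X y n_gt0 lambda_gt0 S.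
have := greedy_value_ge0 X y n_gt0 lambda_gt0 T.
have := Tmin finset.set0; rewrite cards0 => /(_ isT).
rewrite (greedy_value0 X y n_gt0 lambda_gt0) -/N.
move: (greedy_value _ _ _ S) (greedy_value _ _ _ T) => g h h_le h0 g0.
set L := ln _; set c := N * lambda in c0 *.
set F := 1 - _; set y2 := sqnorm y.
(* The bound on [g] factors as the value of the empty set times [F]; extracting [lambda / c] turns
   the factor [lambda * c] into [c ^+ 2]. *)
have -> : lambda * y2 / c - lambda * c * theta_low X k
    / ((c + theta X 1) * (c + theta X k) ^+ 2) * y2 * L = lambda * y2 / c * F.
  rewrite /F -exprMn -/c; field.
  by rewrite !gt_eqF // ltr_pwDl.
move=> gF yh; have y0 : 0 <= lambda * y2 by rewrite mulr_ge0 ?sqnorm_ge0 // ltW.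
(* The estimate [yh] of [lambda * y2] by [h] can be multiplied by [F] only when [F] is
   nonnegative. *)
have [F0|F0] := leP 0 F.
  apply: le_trans gF _; rewrite [leRHS]mulrAC ler_wpM2r //.
  by rewrite [leRHS]mulrAC ler_pM2r ?invr_gt0.
(* [F < 0] forces [y = 0], hence [g = h = 0]. *)
have y2c : lambda * y2 / c = 0.
  apply/eqP; rewrite eq_le divr_ge0 ?(ltW c0) // andbT.
  by rewrite -(nmulr_lge0 _ F0) (le_trans g0).
have -> : h = 0 by apply/eqP; rewrite eq_le h0 -y2c h_le.
by rewrite mulr0 (le_trans gF) // y2c mul0r.
Qed.
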